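(* Let $G$ be a finite simple graph. Then the zeta function $\zeta_G(z)=\prod_{T\in\mathrm{Aut}(G)}\zeta_T(z)$ of the graph $G$ is a rational function.
   Context: For a finite simple graph $G=(V,E)$, a $k$-simplex is a complete subgraph $K_{k+1}$ of $G$ (identified with its vertex set). A $k$-form is a real-valued function $f(x_0,\dots,x_k)$ on ordered $k$-simplices that is antisymmetric in its $k+1$ arguments. The exterior derivative is $df(x_0,\dots,x_{k+1})=\sum_i (-1)^i f(x_0,\dots,\hat{x_i},\dots,x_{k+1})$. The cohomology group $H^k(G)$ is the real vector space of closed $k$-forms ($df=0$) modulo exact $k$-forms ($f=dg$). An automorphism $T\in\mathrm{Aut}(G)$ induces by pull-back $f\mapsto f(T(\cdot),\dots,T(\cdot))$ a linear map $T_k$ on $H^k(G)$, and the Lefschetz number is $L(T)=\sum_{k\ge0}(-1)^k\mathrm{tr}(T_k)$. The Lefschetz zeta function of $T$ is $\zeta_T(z)=\exp\left(\sum_{n=1}^\infty L(T^n)\frac{z^n}{n}\right)$, viewed as a formal power series (or as an analytic function near $z=0$); the assertion is that $\zeta_G$ is the expansion at $0$ of a rational function of $z$. *)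

(* Defs.v *)
From HB Require Import structures.
From mathcomp Require Import all_fingroup all_boot all_order all_algebra.

Set Implicit Arguments.
Unset Strict Implicit.
Unset Printing Implicit Defensive.

Import GRing.Theory.
Local Open Scope ring_scope.

Section VectorSpaceQuotient.
Variables (F : fieldType) (vT : vectType F).

Section QuotientSpace.
Variable U : {vspace vT}.

Definition vquot : Type := Quotient.quot (pred_of_vspace U).

HB.instance Definition _ :
  EqQuotient vT (Quotient.equiv (pred_of_vspace U)) vquot :=
  EqQuotient.on vquot.
HB.instance Definition _ := GRing.Zmodule.on vquot.

Definition vproj (v : vT) : vquot := \pi_vquot%qT v.

Lemma vproj_eq u v : (vproj u == vproj v) = (u - v \in U).
Proof. by rewrite -[RHS]/(Quotient.equiv _ _ _) /vproj piE. Qed.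

Lemma vprojK (q : vquot) : vproj (repr q) = q.
Proof. exact: reprK. Qed.

Lemma vprojB : zmod_morphism vproj.
Proof. by move=> u v; rewrite /vproj; apply: (raddfB (\pi_(Quotient.quot U)%qT)). Qed.

HB.instance Definition _ := GRing.isZmodMorphism.Build vT vquot vproj vprojB.

Definition vquot_scale (a : F) (q : vquot) : vquot := vproj (a *: repr q).

Lemma vquot_scaleE a v : vquot_scale a (vproj v) = vproj (a *: v).
Proof. by apply/eqP; rewrite vproj_eq -scalerBr memvZ// -vproj_eq vprojK. Qed.

Fact vquot_scaleA a b q :
  vquot_scale a (vquot_scale b q) = vquot_scale (a * b) q.
Proof. by rewrite -[q]vprojK !vquot_scaleE scalerA. Qed.
Fact vquot_scale1 : left_id 1 vquot_scale.
Proof. by move=> q; rewrite -[q]vprojK !vquot_scaleE scale1r. Qed.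
Fact vquot_scaleDr : right_distributive vquot_scale +%R.
Proof.
move=> a p q; rewrite -[p]vprojK -[q]vprojK -raddfD !vquot_scaleE.
by rewrite -raddfD scalerDr.
Qed.
Fact vquot_scaleDl q : {morph vquot_scale^~ q : a b / a + b}.
Proof.
by move=> a b; rewrite -[q]vprojK !vquot_scaleE -raddfD scalerDl.
Qed.

HB.instance Definition _ := GRing.Zmodule_isLmodule.Build F vquot
  vquot_scaleA vquot_scale1 vquot_scaleDr vquot_scaleDl.

Fact vproj_scalable : scalable vproj.
Proof. by move=> a v; rewrite -vquot_scaleE. Qed.

HB.instance Definition _ :=
  GRing.isScalable.Build F vT vquot *:%R vproj vproj_scalable.

Fact vquot_vect_iso : Vector.axiom (\dim U^C) vquot.
Proof.
pose p := (\1 - projv U)%VF.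
have pE v : p v = v - projv U v by rewrite add_lfunE opp_lfunE id_lfunE.
have pW v : p v \in (U^C)%VS by rewrite pE memv_projC.
have pid v : v - p v \in U by rewrite pE subKr memv_proj.
have p0 v : v \in U -> p v = 0 by move=> vU; rewrite pE projv_id// subrr.
have pproj v : p (repr (vproj v)) = p v.
  by apply/eqP; rewrite -subr_eq0 -(linearB p) [X in X == _]p0// -vproj_eq vprojK.
exists (fun q => \row_i coord (vbasis U^C) i (p (repr q))).
  move=> a q r; apply/rowP=> i; rewrite !mxE -[q in LHS]vprojK -[r in LHS]vprojK.
  by rewrite -linearZ -linearD/= pproj !linearP.
exists (fun x : 'rV_(\dim U^C) => vproj (\sum_i x 0 i *: (vbasis U^C)`_i)).
  move=> q; rewrite -[RHS]vprojK; apply/eqP; rewrite vproj_eq.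
  under eq_bigr do rewrite mxE.
  by rewrite -coord_vbasis// -memvN opprB.
move=> x; apply/rowP=> i; rewrite mxE pproj.
set w := \sum_i _; have wW : w \in (U^C)%VS.
  by apply: rpred_sum => j _; rewrite rpredZ ?vbasis_mem ?memt_nth.
have -> : p w = w.
  apply/eqP; rewrite eq_sym -subr_eq0 -memv0 -(capv_compl U) memv_cap pid.
  by rewrite memvB.
by rewrite coord_sum_free ?(basis_free (vbasisP _)).
Qed.
HB.instance Definition _ := Lmodule_hasFinDim.Build F vquot vquot_vect_iso.

End QuotientSpace.
End VectorSpaceQuotient.

Definition lfun_trace (F : fieldType) (vT : vectType F) (f : 'End(vT)) : F :=
  \tr (passmx.mxof (vbasis {:vT}) (vbasis {:vT}) f).

Section Graph.
(* The edge relation [e] is meant to be symmetric and irreflexive. *)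
Variables (V : finType) (e : rel V).

Definition is_simplex n (x : {ffun 'I_n -> V}) : bool :=
  [forall i, forall j, (i != j) ==> e (x i) (x j)].

Definition simplex k := {x : {ffun 'I_k.+1 -> V} | is_simplex x}.

Fact reindex_subproof m n (h : 'I_m -> 'I_n) (x : {ffun 'I_n -> V}) :
  injective h -> is_simplex x -> is_simplex [ffun i => x (h i)].
Proof.
move=> injh /forallP xP; apply/forallP=> i; apply/forallP=> j.
apply/implyP=> ij; rewrite !ffunE.
by have /forallP/(_ (h j))/implyP := xP (h i); apply; rewrite (inj_eq injh).
Qed.

Definition face k (i : 'I_k.+2) (x : simplex k.+1) : simplex k :=
  Sub [ffun j => val x (lift i j)] (reindex_subproof (@lift_inj _ i) (valP x)).

Definition permute k (s : 'S_k.+1) (x : simplex k) : simplex k :=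
  Sub [ffun j => val x (s j)] (reindex_subproof (@perm_inj _ s) (valP x)).

Definition automorphisms : {set {perm V}} :=
  [set s : {perm V} | [forall x, forall y, e (s x) (s y) == e x y]].

Lemma automorphismsP (s : {perm V}) :
  reflect (forall x y, e (s x) (s y) = e x y) (s \in automorphisms).
Proof.
rewrite inE; apply: (iffP forallP) => [sP x y|sP x].
  by have /forallP/(_ y)/eqP := sP x.
by apply/forallP=> y; rewrite sP.
Qed.

Fact automorphisms_group_set : group_set automorphisms.
Proof.
apply/group_setP; split=> [|s t /automorphismsP sP /automorphismsP tP].
  by apply/automorphismsP=> x y; rewrite !perm1.
by apply/automorphismsP=> x y; rewrite !permM tP sP.
Qed.
Canonical automorphism_group := fingroup.Group automorphisms_group_set.

Definition graph_aut := subg_of automorphism_group.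

Fact aut_simplex_subproof (T : graph_aut) n (x : {ffun 'I_n -> V}) :
  is_simplex x -> is_simplex [ffun i => sgval T (x i)].
Proof.
move=> /forallP xP; apply/forallP=> i; apply/forallP=> j; rewrite !ffunE.
by rewrite (automorphismsP _ (subgP T)); apply/forallP: j.
Qed.

Definition aut_simplex (T : graph_aut) k (x : simplex k) : simplex k :=
  Sub [ffun j => sgval T (val x j)] (aut_simplex_subproof T (valP x)).

Lemma aut_simplex_face T k (i : 'I_k.+2) x :
  aut_simplex T (face i x) = face i (aut_simplex T x).
Proof. by apply/val_inj/ffunP=> j; rewrite !ffunE. Qed.

Lemma aut_simplex_permute T k (s : 'S_k.+1) x :
  aut_simplex T (permute s x) = permute s (aut_simplex T x).
Proof. by apply/val_inj/ffunP=> j; rewrite !ffunE. Qed.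

Lemma simplex_bound k : irreflexive e -> simplex k -> (k < #|V|)%N.
Proof.
move=> eirr x; rewrite -[k.+1]card_ord; apply: (@leq_card _ _ (val x)) => i j xij.
apply/eqP; apply: contraT => ij.
by have /forallP/(_ i)/forallP/(_ j) := valP x; rewrite ij xij eirr.
Qed.

Section Cohomology.
Variable F : fieldType.

(* Arbitrary functions on ordered simplices; the forms are the antisymmetric
   ones. *)
Definition cochain k := {ffun simplex k -> F^o}.

Definition antisym_defect k (s : 'S_k.+1) (f : cochain k) : cochain k :=
  [ffun x => f (permute s x) - (-1) ^+ s * f x].

Fact antisym_defect_linear k s : linear (@antisym_defect k s).
Proof.
move=> a f g; apply/ffunP=> x; rewrite !ffunE mulrDr scalerBr opprD addrACA.
by rewrite scalerAr.
Qed.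
HB.instance Definition _ k s := GRing.isLinear.Build F (cochain k) (cochain k)
  *:%R (antisym_defect s) (@antisym_defect_linear k s).

Definition forms k : {vspace cochain k} :=
  (\bigcap_(s : 'S_k.+1) lker (linfun (antisym_defect s)))%VS.

Lemma formsP k (f : cochain k) :
  reflect (forall s x, f (permute s x) = (-1) ^+ s * f x) (f \in forms k).
Proof.
apply: (iffP idP) => [/subv_bigcapP fP s x|fP].
  have /(_ s isT) := fP; rewrite -memvE memv_ker lfunE => /eqP/ffunP/(_ x)/eqP.
  by rewrite !ffunE subr_eq0 => /eqP.
apply/subv_bigcapP=> s _; rewrite -memvE memv_ker lfunE; apply/eqP/ffunP=> x.
by rewrite !ffunE fP subrr.
Qed.

Definition ext_deriv_fun k (f : cochain k) : cochain k.+1 :=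
  [ffun x => \sum_(i < k.+2) (-1) ^+ i * f (face i x)].

Fact ext_deriv_linear k : linear (@ext_deriv_fun k).
Proof.
move=> a f g; apply/ffunP=> x; rewrite !ffunE scaler_sumr -big_split.
by apply: eq_bigr => i _; rewrite !ffunE mulrDr scalerAr.
Qed.
HB.instance Definition _ k := GRing.isLinear.Build F (cochain k) (cochain k.+1)
  *:%R (@ext_deriv_fun k) (@ext_deriv_linear k).

Definition ext_deriv k : 'Hom(cochain k, cochain k.+1) :=
  linfun (@ext_deriv_fun k).

Definition closed_forms k : {vspace cochain k} :=
  (forms k :&: lker (ext_deriv k))%VS.

Definition exact_forms k : {vspace cochain k} :=
  match k with
  | 0 => 0%VS
  | k'.+1 => (ext_deriv k' @: forms k')%VS
  end.

(* The exact forms [exact_forms k], inside the space of closed forms: the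
   quotient below identifies closed forms differing by an exact form. *)
Definition exact_in_closed k : {vspace subvs_of (closed_forms k)} :=
  (linfun vsval @^-1: exact_forms k)%VS.

Definition cohomology k := vquot (exact_in_closed k).

Definition pullback_fun (T : graph_aut) k (f : cochain k) : cochain k :=
  [ffun x => f (aut_simplex T x)].

Fact pullback_linear T k : linear (@pullback_fun T k).
Proof. by move=> a f g; apply/ffunP=> x; rewrite !ffunE. Qed.
HB.instance Definition _ T k := GRing.isLinear.Build F (cochain k) (cochain k)
  *:%R (@pullback_fun T k) (@pullback_linear T k).

Definition pullback T k : 'End(cochain k) := linfun (@pullback_fun T k).

Lemma pullback_forms T k f : f \in forms k -> pullback T k f \in forms k.
Proof.
move=> /formsP fP; apply/formsP=> s x.
by rewrite /pullback lfunE !ffunE aut_simplex_permute fP.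
Qed.

Lemma pullback_ext_deriv T k f :
  pullback T k.+1 (ext_deriv k f) = ext_deriv k (pullback T k f).
Proof.
rewrite /pullback /ext_deriv !lfunE/=; apply/ffunP=> x; rewrite !ffunE.
by apply: eq_bigr => i _; rewrite ffunE aut_simplex_face.
Qed.

Lemma pullback_closed T k f :
  f \in closed_forms k -> pullback T k f \in closed_forms k.
Proof.
rewrite !memv_cap => /andP[/(pullback_forms T)-> /=].
by rewrite !memv_ker -pullback_ext_deriv => /eqP->; rewrite linear0.
Qed.

Lemma pullback_exact T k f :
  f \in exact_forms k -> pullback T k f \in exact_forms k.
Proof.
case: k f => [|k] f /=; first by rewrite !memv0 => /eqP->; rewrite linear0.
case/memv_imgP=> g gP ->; rewrite pullback_ext_deriv memv_img//.
exact: pullback_forms.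
Qed.

Definition closed_pullback_fun (T : graph_aut) k
    (w : subvs_of (closed_forms k)) : subvs_of (closed_forms k) :=
  Subvs (pullback_closed T (subvsP w)).

Fact closed_pullback_linear T k : linear (@closed_pullback_fun T k).
Proof. by move=> a u v; apply/val_inj; rewrite /= linearP. Qed.
HB.instance Definition _ T k := GRing.isLinear.Build F
  (subvs_of (closed_forms k)) (subvs_of (closed_forms k))
  *:%R (@closed_pullback_fun T k) (@closed_pullback_linear T k).

Definition coh_pullback_fun (T : graph_aut) k (c : cohomology k) :
    cohomology k :=
  vproj _ (closed_pullback_fun T (repr c)).

Lemma coh_pullback_funE T k (w : subvs_of (closed_forms k)) :
  @coh_pullback_fun T k (vproj _ w) = vproj _ (closed_pullback_fun T w).
Proof.
apply/eqP; rewrite vproj_eq -linearB -memv_preim lfunE pullback_exact//.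
have : repr (vproj (exact_in_closed k) w) - w \in exact_in_closed k.
  by rewrite -vproj_eq vprojK.
by rewrite -memv_preim lfunE.
Qed.

Fact coh_pullback_linear T k : linear (@coh_pullback_fun T k).
Proof.
move=> a c c'; rewrite -[c]vprojK -[c']vprojK -linearP !coh_pullback_funE.
by rewrite !linearP.
Qed.
HB.instance Definition _ T k := GRing.isLinear.Build F
  (cohomology k) (cohomology k)
  *:%R (@coh_pullback_fun T k) (@coh_pullback_linear T k).

Definition coh_pullback (T : graph_aut) k : 'End(cohomology k) :=
  linfun (@coh_pullback_fun T k).

Lemma cohomology_trivial k :
  irreflexive e -> (#|V| <= k)%N -> forall c : cohomology k, c = 0.
Proof.
move=> eirr kV c; rewrite -[c]vprojK -[RHS](linear0 (vproj _)).
congr vproj; apply/val_inj/ffunP=> x.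
by have := leq_trans (simplex_bound eirr x) kV; rewrite ltnn.
Qed.

(* The cohomology vanishes in degree #|V| and above (cohomology_trivial). *)
Definition lefschetz_number (T : graph_aut) : F :=
  \sum_(k < #|V|) (-1) ^+ k * lfun_trace (coh_pullback T k).

End Cohomology.
End Graph.

(* A formal power series is represented by its sequence of coefficients. *)
Section PowerSeries.
Variable F : fieldType.
Implicit Types f g : nat -> F.

Definition fps_one : nat -> F := fun n => (n == 0)%:R.

Definition fps_mul f g : nat -> F :=
  fun n => \sum_(i < n.+1) f i * g (n - i)%N.

Definition fps_pow f k : nat -> F := iter k (fps_mul f) fps_one.

(* exp f = \sum_k f ^ k / k!, for f without constant term: then f ^ k has no
   term of degree less than k, so only k <= n matters in degree n. *)
Definition fps_exp f : nat -> F :=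
  fun n => \sum_(k < n.+1) (k`!%:R)^-1 * fps_pow f k n.

Definition fps_of_poly (p : {poly F}) : nat -> F := fun n => p`_n.

(* f is the expansion at 0 of the fraction p / q, regular at 0. *)
Definition fps_rational f : Prop :=
  exists p q : {poly F}, q`_0 != 0 /\ fps_mul (fps_of_poly q) f =1 fps_of_poly p.

End PowerSeries.

Section Zeta.
Variables (F : fieldType) (V : finType) (e : rel V).

Definition lefschetz_zeta (T : graph_aut e) : nat -> F :=
  fps_exp (fun n =>
    if n is 0 then 0 else lefschetz_number F (T ^+ n)%g / n%:R).

Definition graph_zeta : nat -> F :=
  \big[@fps_mul F/@fps_one F]_(T : graph_aut e) lefschetz_zeta T.

End Zeta.

(* Main.v *)
Require Import Defs.
From mathcomp Require Import all_boot all_order all_algebra all_fingroup.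
From mathcomp Require Import boolp reals.

(** The zeta function is controlled by its logarithmic derivative.  For a power
series f with constant term 1 write theta f = z f' and say that f has
logarithmic derivative l when theta f = l f.  In characteristic 0 such an f is
determined by l ([has_logder_inj]), logarithmic derivatives add up under
products ([has_logder_mul]), and exp g has logarithmic derivative theta g
([has_logder_exp]).  So the Lefschetz zeta function of T has logarithmic
derivative sum_(n >= 1) L(T^n) z^n.

On the other hand, for a square matrix A the polynomial det(1 - z A) has
logarithmic derivative - sum_(n >= 1) tr(A^n) z^n ([has_logder_rev_char_poly]):
by Jacobi's formula its derivative is - tr(A adj(1 - z A)), and the identity
adj(1 - z A) (1 - z A) = det(1 - z A) expresses the coefficients of the
adjugate through the powers of A.  The action on cohomology is compatible with
powers of T ([coh_mxX]), hence, T_k being the matrix of T on H^k, the product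
of the det(1 - z T_k) over T and over even k, times the zeta function of the
graph, has the same logarithmic derivative as the product of the det(1 - z T_k)
over T and over odd k.  The two are therefore equal, and the zeta function is
the quotient of two polynomials with constant term 1. *)

Set Implicit Arguments.
Unset Strict Implicit.
Unset Printing Implicit Defensive.

Import GRing.Theory Num.Theory.
Local Open Scope ring_scope.

(** * Formal power series and logarithmic derivatives *)

Section PowerSeriesRing.
Variable F : fieldType.
Implicit Types (f g h : nat -> F) (p q : {poly F}).

Definition fps_add f g : nat -> F := fun n => f n + g n.

(** The first n + 1 coefficients of a product depend only on those of the
factors, so ring identities for power series reduce to identities between
polynomials. *)
Lemma coef_fps_mul p q f g n :
  (forall i, (i <= n)%N -> p`_i = f i) ->
  (forall i, (i <= n)%N -> q`_i = g i) ->
  (p * q)`_n = fps_mul f g n.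
Proof.
move=> pf qg; rewrite coefM; apply: eq_bigr => i _.
by rewrite pf ?qg ?leq_subr// -ltnS.
Qed.

(** The truncation of a power series modulo X^(n + 1). *)
Definition fps_trunc n f : {poly F} := \poly_(i < n.+1) f i.

Lemma coef_fps_trunc n f i : (i <= n)%N -> (fps_trunc n f)`_i = f i.
Proof. by move=> le_in; rewrite coef_poly ltnS le_in. Qed.

Lemma fps_mulE f g n : fps_mul f g n = (fps_trunc n f * fps_trunc n g)`_n.
Proof. by symmetry; apply: coef_fps_mul => i; apply: coef_fps_trunc. Qed.

Lemma fps_of_polyM p q :
  fps_of_poly (p * q) = fps_mul (fps_of_poly p) (fps_of_poly q).
Proof. by apply/funext => n; apply: coef_fps_mul. Qed.

Lemma fps_of_poly1 : fps_of_poly 1 = @fps_one F.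
Proof. by apply/funext => n; rewrite /fps_of_poly coef1. Qed.

Lemma fps_mulC f g : fps_mul f g = fps_mul g f.
Proof. by apply/funext => n; rewrite !fps_mulE mulrC. Qed.

Lemma fps_mulA f g h : fps_mul f (fps_mul g h) = fps_mul (fps_mul f g) h.
Proof.
have trM u v n i : (i <= n)%N ->
    (fps_trunc n u * fps_trunc n v)`_i = fps_mul u v i.
  move=> le_in; apply: coef_fps_mul => j le_ji;
    by rewrite coef_fps_trunc// (leq_trans le_ji).
apply/funext => n; transitivity
    (fps_trunc n f * (fps_trunc n g * fps_trunc n h))`_n.
  by symmetry; apply: coef_fps_mul => i le_in; rewrite ?trM ?coef_fps_trunc.
by rewrite mulrA; apply: coef_fps_mul => i le_in;
  rewrite ?trM ?coef_fps_trunc.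
Qed.

Lemma fps_mulDl f g h :
  fps_mul (fps_add f g) h = fps_add (fps_mul f h) (fps_mul g h).
Proof.
apply/funext => n; rewrite /fps_mul /fps_add -big_split.
by apply: eq_bigr => i _; rewrite mulrDl.
Qed.

Lemma coef0_fps_mul f g : fps_mul f g 0 = f 0 * g 0.
Proof. by rewrite /fps_mul big_ord1. Qed.

(** The Euler derivation z d/dz. *)
Definition fps_theta f : nat -> F := fun n => n%:R * f n.

Lemma fps_thetaM f g :
  fps_theta (fps_mul f g) =
  fps_add (fps_mul (fps_theta f) g) (fps_mul f (fps_theta g)).
Proof.
apply/funext => n; rewrite /fps_theta /fps_mul /fps_add mulr_sumr -big_split.
apply: eq_bigr => i _ /=; rewrite mulrCA [i%:R * _]mulrC -mulrA -mulrDr.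
rewrite -mulrDl -natrD.
by rewrite subnKC// -ltnS.
Qed.

(** f has constant term 1 and logarithmic derivative z f' / f = l. *)
Definition has_logder f l := f 0 = 1 /\ fps_theta f = fps_mul l f.

Lemma has_logder_one : has_logder (@fps_one F) (fun=> 0).
Proof.
split=> //; apply/funext => n; rewrite /fps_mul big1 => [|i _]; last first.
  by rewrite mul0r.
by rewrite /fps_theta /fps_one; case: n => [|n]; rewrite ?mul0r ?mulr0.
Qed.

Lemma has_logder_mul f g l m :
  has_logder f l -> has_logder g m ->
  has_logder (fps_mul f g) (fps_add l m).
Proof.
case=> f0 df [g0 dg]; split; first by rewrite coef0_fps_mul f0 g0 mulr1.
rewrite fps_thetaM df dg fps_mulDl -!fps_mulA; congr fps_add.
by rewrite fps_mulA [fps_mul f m]fps_mulC -fps_mulA.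
Qed.

Lemma has_logder_prod (I : Type) (r : seq I) (P : pred I)
    (f l : I -> nat -> F) :
  (forall i, P i -> has_logder (f i) (l i)) ->
  has_logder (\big[@fps_mul F/@fps_one F]_(i <- r | P i) f i)
             (fun n => \sum_(i <- r | P i) l i n).
Proof.
move=> fl; elim: r => [|i r IHr].
  rewrite big_nil; have -> : (fun n => \sum_(i <- [::] | P i) l i n) = fun=> 0.
    by apply/funext => n; rewrite big_nil.
  exact: has_logder_one.
have -> : (fun n => \sum_(i <- i :: r | P i) l i n) =
    if P i then fps_add (l i) (fun n => \sum_(i <- r | P i) l i n)
    else (fun n => \sum_(i <- r | P i) l i n).
  by apply/funext => n; rewrite big_cons; case: (P i).
by rewrite big_cons; case: ifP => // /fl/has_logder_mul; apply.
Qed.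

Lemma fps_of_poly_prod (I : Type) (r : seq I) (P : pred I) (p : I -> {poly F}) :
  fps_of_poly (\prod_(i <- r | P i) p i) =
  \big[@fps_mul F/@fps_one F]_(i <- r | P i) fps_of_poly (p i).
Proof. exact: (big_morph _ fps_of_polyM fps_of_poly1). Qed.

Lemma fps_powS f k : fps_pow f k.+1 = fps_mul f (fps_pow f k).
Proof. by []. Qed.

(** The k-th power of a series without constant term has order at least k. *)
Lemma fps_pow_small f k n : f 0 = 0 -> (n < k)%N -> fps_pow f k n = 0.
Proof.
move=> f0; elim: k n => // k IHk n lt_nk; rewrite fps_powS /fps_mul.
rewrite big1// => -[[|i] lti] _ /=; first by rewrite f0 mul0r.
rewrite IHk ?mulr0//; case: n lti lt_nk => // n _ lt_nk.
by rewrite subSS (leq_ltn_trans (leq_subr _ _)).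
Qed.

Lemma fps_theta_pow f k n :
  fps_theta (fps_pow f k.+1) n =
  k.+1%:R * fps_mul (fps_theta f) (fps_pow f k) n.
Proof.
elim: k n => [|k IHk] n.
  rewrite fps_powS fps_thetaM /fps_add mul1r.
  have -> : fps_theta (fps_pow f 0) = fun=> 0.
    apply/funext => -[|m]; rewrite /fps_theta ?mul0r//.
    by rewrite /fps_pow/= /fps_one mulr0.
  by rewrite [X in _ + X]big1 ?addr0// => i _; rewrite mulr0.
rewrite fps_powS fps_thetaM /fps_add.
have -> : fps_theta (fps_pow f k.+1) =
    fun n => k.+1%:R * fps_mul (fps_theta f) (fps_pow f k) n.
  by apply/funext.
rewrite -[in RHS](natr1 k.+1) mulrDl mul1r addrC; congr (_ + _).
rewrite fps_powS fps_mulA [fps_mul _ f]fps_mulC -fps_mulA /fps_mul mulr_sumr.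
by apply: eq_bigr => i _; rewrite mulrCA.
Qed.

Hypothesis F_char0 : forall n, n.+1%:R != 0 :> F.

Lemma fact_unit n : n`!%:R != 0 :> F.
Proof. by rewrite -(prednK (fact_gt0 n)). Qed.

(** The coefficient of degree n of exp f may be computed from any number N > n
of terms of the exponential series. *)
Lemma fps_exp_extend f N n : f 0 = 0 -> (n < N)%N ->
  fps_exp f n = \sum_(k < N) (k`!%:R)^-1 * fps_pow f k n.
Proof.
move=> f0 lt_nN; rewrite /fps_exp -(subnKC lt_nN) big_split_ord/=.
rewrite [X in _ = _ + X]big1 ?addr0// => i _.
by rewrite -fps_powS fps_pow_small ?mulr0// ltnS leq_addr.
Qed.

Lemma has_logder_exp f : f 0 = 0 -> has_logder (fps_exp f) (fps_theta f).
Proof.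
move=> f0; split.
  by rewrite /fps_exp big_ord1 fact0 invr1 mul1r.
apply/funext => n; rewrite {1}/fps_theta {1}/fps_exp mulr_sumr big_ord_recl.
rewrite [X in X + _](_ : _ = 0) ?add0r; last first.
  by rewrite /fps_pow/= /fps_one; case: n => [|n]; rewrite ?mul0r ?mulr0.
transitivity
    (\sum_(k < n) (k`!%:R)^-1 * fps_mul (fps_theta f) (fps_pow f k) n).
  apply: eq_bigr => k _; rewrite mulrCA.
  have := fps_theta_pow f k n; rewrite {1}/fps_theta => ->.
  by rewrite mulrA lift0 factS natrM invfM [_ / _ * _]mulrAC mulVf ?mul1r.
(* The i-th term of the convolution involves the coefficient n - i < n of exp f
   when i > 0, for which the n terms k < n are enough. *)
rewrite /fps_mul.
under eq_bigr => k _ do rewrite mulr_sumr.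
rewrite exchange_big; apply: eq_bigr => -[[|i] lt_in] _ /=.
  rewrite /fps_theta !mul0r; apply: big1 => k _.
  by rewrite !mul0r mulr0.
rewrite (@fps_exp_extend _ n)// ?mulr_sumr; last first.
  by case: n lt_in => // n _; rewrite subSS ltnS leq_subr.
by apply: eq_bigr => k _; rewrite mulrCA.
Qed.

(** As theta f has no constant term and f has constant term 1, l has no constant
term either; so theta f = l f determines the coefficients of f recursively. *)
Lemma has_logder_inj f g l : has_logder f l -> has_logder g l -> f = g.
Proof.
case=> f0 df [g0 dg]; apply/funext => n.
have l0 : l 0 = 0.
  by rewrite -[RHS](mul0r (f 0)) -[RHS]/(fps_theta f 0) df coef0_fps_mul f0 mulr1.
have [m le_nm] : exists m, (n <= m)%N by exists n.
elim: m n le_nm => [|m IHm] [|n] le_nm; rewrite ?f0 ?g0//.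
apply: (mulfI (F_char0 n)).
rewrite -[LHS]/(fps_theta f n.+1) -[RHS]/(fps_theta g n.+1) df dg /fps_mul.
rewrite big_ord_recl [in RHS]big_ord_recl l0 !mul0r; congr (_ + _).
apply: eq_bigr => i _.
by rewrite IHm// lift0 subSS (leq_trans (leq_subr _ _)).
Qed.

End PowerSeriesRing.

(** * Jacobi's formula for the derivative of a determinant *)

Section DetDerivative.
Variable R : comNzRingType.

Lemma deriv_prod_seq (I : eqType) (r : seq I) (f : I -> {poly R}) :
  uniq r ->
  (\prod_(i <- r) f i)^`() =
  \sum_(i <- r) \prod_(j <- r) (if j == i then (f j)^`() else f j).
Proof.
elim: r => [|a r IHr] /=; first by rewrite !big_nil -polyC1 derivC.
case/andP=> ar uniq_r; rewrite !big_cons derivM IHr// eqxx; congr (_ + _).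
  congr (_ * _); apply: eq_big_seq => j jr.
  by case: eqP => // ja; rewrite -ja jr in ar.
rewrite mulr_sumr; apply: eq_big_seq => i ir.
by rewrite big_cons; case: eqP => // ai; rewrite ai ir in ar.
Qed.

Lemma deriv_det n (M : 'M[{poly R}]_n) :
  (\det M)^`() = \tr (map_mx deriv M *m \adj M).
Proof.
(* N i is M with its i-th row differentiated; it has the same cofactors as M
   along that row. *)
pose N i := \matrix_(a, b) if a == i then (M a b)^`() else M a b.
transitivity (\sum_i \det (N i)).
  rewrite /determinant linear_sum exchange_big; apply: eq_bigr => s _ /=.
  rewrite -mulr_sumr -signr_odd; case: (odd _) => /=.
    rewrite expr1 !mulN1r derivN; congr (- _).
    rewrite deriv_prod_seq ?index_enum_uniq//; apply: eq_bigr => i _.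
    by apply: eq_bigr => j _; rewrite mxE.
  rewrite !mul1r deriv_prod_seq ?index_enum_uniq//; apply: eq_bigr => i _.
  by apply: eq_bigr => j _; rewrite mxE.
apply: eq_bigr => i _; rewrite (expand_det_row _ i) mxE.
apply: eq_bigr => j _; rewrite !mxE eqxx; congr (_ * (_ * \det _)).
by apply/matrixP => a b; rewrite !mxE eq_sym (negPf (neq_lift _ _)).
Qed.

End DetDerivative.

(** * The reverse characteristic polynomial *)

Section ReverseCharPoly.
Variables (F : fieldType) (n : nat) (A : 'M[F]_n).

(** The polynomial matrix 1 - X A. *)
Definition one_sub_Xmx : 'M[{poly F}]_n := 1%:M - 'X *: map_mx polyC A.

(** The reverse characteristic polynomial det(1 - X A). *)
Definition rev_char_poly : {poly F} := \det one_sub_Xmx.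

(* The coefficient of degree k of the adjugate of 1 - X A. *)
Let B k : 'M[F]_n := map_mx (coefp k) (\adj one_sub_Xmx).

(** The degree k + 1 part of adj(1 - X A) (1 - X A) = det(1 - X A). *)
Lemma adj_coefS k : B k.+1 = rev_char_poly`_k.+1 *: 1%:M + B k *m A.
Proof.
apply/eqP; rewrite -subr_eq; apply/eqP.
have /matrixP adjE := mul_adj_mx one_sub_Xmx.
apply/matrixP => i j; have := congr1 (coefp k.+1) (adjE i j).
rewrite mulmxBr mulmx1 -scalemxAr !mxE/=.
rewrite coefB coefXM/= coef_sum coefMn mulr_natr => <-.
rewrite -/rev_char_poly; congr (_ - _).
by apply: eq_bigr => a _; rewrite !mxE coefMC.
Qed.

Lemma adj_coefE k : B k = \sum_(i < k.+1) rev_char_poly`_(k - i) *: A ^+ i.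
Proof.
elim: k => [|k IHk].
  rewrite big_ord1 expr0; apply/matrixP => i j.
  have /matrixP/(_ i j)/(congr1 (coefp 0)) := mul_adj_mx one_sub_Xmx.
  rewrite mulmxBr mulmx1 -scalemxAr !mxE/=.
  by rewrite coefB coefXM subr0 coefMn mulr_natr => ->.
rewrite adj_coefS IHk [in RHS]big_ord_recl expr0 mulmx_suml; congr (_ + _).
by apply: eq_bigr => i _; rewrite -scalemxAl lift0 subSS exprSr.
Qed.

Lemma rev_char_poly0 : rev_char_poly`_0 = 1.
Proof.
rewrite -horner_coef0 -[LHS]/(horner_eval 0 _) -det_map_mx.
rewrite [X in \det X](_ : _ = 1%:M) ?det1//; apply/matrixP => i j.
rewrite !mxE /= /horner_eval hornerD hornerN hornerM hornerX mul0r subr0.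
by case: (i == j); rewrite hornerC.
Qed.

Lemma has_logder_rev_char_poly :
  has_logder (fps_of_poly rev_char_poly)
             (fun k => if k is 0 then 0 else - \tr (A ^+ k)).
Proof.
split; first exact: rev_char_poly0.
apply/funext => -[|k]; rewrite /fps_theta; first by rewrite coef0_fps_mul !mul0r.
have dM : map_mx deriv one_sub_Xmx = - map_mx polyC A.
  apply/matrixP => i j; rewrite !mxE derivB derivM derivC derivX mulr0 addr0.
  by rewrite mul1r -polyCMn derivC sub0r.
have := congr1 (coefp k) (deriv_det one_sub_Xmx).
rewrite /= coef_deriv mulr_natl.
rewrite [fps_of_poly _ k.+1]/(rev_char_poly`_k.+1) => ->.
have -> : (\tr (map_mx deriv one_sub_Xmx *m \adj one_sub_Xmx))`_k =
    - \tr (A *m B k).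
  rewrite dM mulNmx linearN coefN; congr (- _).
  rewrite coef_sum; apply: eq_bigr => i _; rewrite !mxE coef_sum.
  by apply: eq_bigr => j _; rewrite !mxE coefCM.
rewrite /fps_mul big_ord_recl mul0r add0r adj_coefE mulmx_sumr.
rewrite (linear_sum (@mxtrace F n)) -sumrN.
apply: eq_bigr => i _; rewrite lift0 subSS -scalemxAr exprS linearZ /=.
by rewrite mulNr mulrC.
Qed.

End ReverseCharPoly.

(** * The action of automorphisms on cohomology *)

Section Lefschetz.
Variables (F : fieldType) (V : finType) (e : rel V).
Implicit Types (S T : graph_aut e).

Lemma aut_simplex1 k (x : simplex e k) : aut_simplex (1 : graph_aut e)%g x = x.
Proof. by apply/val_inj/ffunP => j; rewrite ffunE perm1. Qed.

(** The product S * T of permutations applies S first. *)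
Lemma aut_simplexM S T k (x : simplex e k) :
  aut_simplex (S * T)%g x = aut_simplex T (aut_simplex S x).
Proof. by apply/val_inj/ffunP => j; rewrite !ffunE permM. Qed.

Lemma coh_pullback1 k : coh_pullback F (1 : graph_aut e)%g k = \1%VF.
Proof.
apply/lfunP => c; rewrite id_lfunE lfunE /= -[c]vprojK coh_pullback_funE.
congr vproj; apply/val_inj => /=; rewrite lfunE /=.
by apply/ffunP => x; rewrite ffunE aut_simplex1.
Qed.

Lemma coh_pullbackM S T k :
  coh_pullback F (S * T)%g k = (coh_pullback F S k \o coh_pullback F T k)%VF.
Proof.
apply/lfunP => c; rewrite comp_lfunE !lfunE /= -[c]vprojK.
move: (generic_quotient.repr c) => {c} w.
rewrite (coh_pullback_funE T w) !coh_pullback_funE.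
congr vproj; apply/val_inj => /=; rewrite !lfunE /=.
by apply/ffunP => x; rewrite !ffunE aut_simplexM.
Qed.

(** The matrix, acting on row vectors, of the map induced by T on H^k. *)
Definition coh_mx T k :=
  passmx.mxof (vbasis {:cohomology e F k}) (vbasis {:cohomology e F k})
    (coh_pullback F T k).

Lemma coh_mxX T k n : coh_mx (T ^+ n)%g k = coh_mx T k ^+ n.
Proof.
have bas := vbasisP {:cohomology e F k}.
elim: n => [|n IHn].
  by rewrite expg0 expr0 /coh_mx coh_pullback1 passmx.mxof1// (basis_free bas).
by rewrite expgSr exprS -IHn /coh_mx coh_pullbackM (passmx.mxof_comp _ _ bas).
Qed.

Lemma lefschetz_numberX T n :
  lefschetz_number F (T ^+ n)%g =
  \sum_(k < #|V|) (-1) ^+ k * \tr (coh_mx T k ^+ n).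
Proof. by apply: eq_bigr => k _; rewrite -coh_mxX. Qed.

End Lefschetz.

Theorem corollary6p4 (R : realType) (V : finType) (e : rel V)
  (e_sym : symmetric e) (e_irr : irreflexive e) :
  fps_rational (graph_zeta R e).
Proof.
have R_char0 n : n.+1%:R != 0 :> R by rewrite pnatr_eq0.
pose q (T : graph_aut e) (k : 'I_#|V|) := rev_char_poly (coh_mx R T k).
pose q_logder (T : graph_aut e) (k : 'I_#|V|) n : R :=
  if n is 0 then 0 else - \tr (coh_mx R T k ^+ n).
exists (\prod_(T : graph_aut e) \prod_(k < #|V| | odd k) q T k).
exists (\prod_(T : graph_aut e) \prod_(k < #|V| | ~~ odd k) q T k).
have logder_q (P : pred 'I_#|V|) : has_logder
    (fps_of_poly (\prod_(T : graph_aut e) \prod_(k | P k) q T k))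
    (fun n => \sum_(T : graph_aut e) \sum_(k | P k) q_logder T k n).
  rewrite fps_of_poly_prod; apply: has_logder_prod => T _.
  rewrite fps_of_poly_prod; apply: has_logder_prod => k _.
  exact: has_logder_rev_char_poly.
have logder_zeta : has_logder (graph_zeta R e)
    (fun n => \sum_(T : graph_aut e) fps_theta (fun n =>
       if n is 0 then 0 else lefschetz_number R (T ^+ n)%g / n%:R) n).
  by apply: has_logder_prod => T _; apply: has_logder_exp.
split.
  have [q0 _] := logder_q (fun k => ~~ odd k).
  by rewrite -[_`_0]/(fps_of_poly _ 0%N) q0 oner_neq0.
move=> n; congr (_ n); apply: (has_logder_inj R_char0) (logder_q _).
have := has_logder_mul (logder_q (fun k => ~~ odd k)) logder_zeta.
congr has_logder; apply/funext => -[|m]; rewrite /fps_add /fps_theta -big_split.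
  apply: eq_bigr => T _ /=; rewrite mul0r addr0.
  by rewrite !big1.
apply: eq_bigr => T _ /=.
rewrite mulrC divfK// lefschetz_numberX.
(* In the alternating sum for L(T^n) the even degrees cancel against the
   denominator and the odd ones are left with sign -1. *)
rewrite [X in _ + X](bigID (fun k : 'I__ => ~~ odd k)) /= addrA -big_split /=.
rewrite [X in X + _]big1 ?add0r; last first.
  by move=> k even_k; rewrite -signr_odd (negPf even_k) mul1r addNr.
apply: eq_big => k; first by rewrite negbK.
by rewrite negbK => odd_k; rewrite -signr_odd odd_k mulN1r.
Qed.
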